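(* For every integer $d\ge 0$, $$H_d = \sum_{\delta\in \mathrm{PCom}_{\mathrm{dyad}}'(d)} E^+_\delta.$$
   Context: A composition of $n\ge 0$ is a finite tuple of positive integers with sum $n$; its length $\ell$ is the number of entries; the empty composition is the only composition of $0$. A polycomposition of $n$ is a sequence $\delta=(\alpha^{(1)},\alpha^{(2)},\dots)$ of (possibly empty) compositions with $\sum_{i\ge1} i|\alpha^{(i)}|=n$, where $|\alpha|$ is the sum of the entries of $\alpha$; write $\delta|^i=\alpha^{(i)}$. Each part $d$ of $\delta|^r$ gives a block $d^r$ of $\delta$ (degree $d$, multiplicity $r$; not exponentiation). $\mathrm{PCom}'_{\mathrm{dyad}}(d)$ is the set of polycompositions $\delta$ of $d$ such that all multiplicities are powers of $2$ (i.e. $\delta|^i$ is empty unless $i=2^k$ for some $k\ge 0$) and $\ell(\delta|^i)\le 1$ for all $i\ge1$. Let $x_{i,j}$ ($i,j\ge 1$) be indeterminates with $\deg x_{i,j}=i$; all series have rational coefficients. A monomial is square-free if every exponent is at most $1$. For $d\ge 0$, $H_d$ is the sum of all monomials of degree $d$ and $E^+_d$ is the sum of all square-free monomials of degree $d$. For a block $d^r$, $E^+_{d^r}$ is obtained from $E^+_d$ by replacing each $x_{i,j}$ by $x_{i,j}^r$, and $E^+_\delta=\prod E^+_{d^r}$ over all blocks $d^r$ of $\delta$ (counted with repetition; empty product $=1$). *)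

(* Defs.v *)
From HB Require Import structures.
From mathcomp Require Import all_boot all_order all_algebra.
From mathcomp Require Import finmap.
From mathcomp Require Import boolp classical_sets functions cardinality fsbigop.
From mathcomp Require Import monalg.
Set Implicit Arguments.
Unset Strict Implicit.
Unset Printing Implicit Defensive.
Import Order.TTheory GRing.Theory Num.Theory.
Local Open Scope classical_set_scope.
Local Open Scope ring_scope.

(* Formal power series in arbitrarily many commuting variables.  All families *)
(* of coefficients are allowed, so a series may involve infinitely many       *)
(* variables even when it is homogeneous.  The record keeps the convolution   *)
(* product apart from the pointwise product of functions.                     *)

Record pseries (I : choiceType) (R : Type) :=
  PSeries { pcoef : {cmonom I} -> R }.

Definition mfactors (I : choiceType) (m : {cmonom I}) :
    set ({cmonom I} * {cmonom I}) :=
  [set p | mmul p.1 p.2 = m].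

Section PSeriesRing.
Context {I : choiceType}.
Implicit Types m a b : {cmonom I}.

Lemma cmonom_eqP a b : (forall i, a i = b i) -> a = b.
Proof. by move=> h; apply/eqP/cmP. Qed.

Definition mdivs m : set {cmonom I} := [set a | exists b, mmul a b = m].

Lemma finite_mdivs m : finite_set (mdivs m).
Proof.
pose N := (\max_(i <- finsupp m) m i)%N.
have leN i : (m i <= N)%N.
  case: (mdomP m i) => // mi; by apply: (@leq_bigmax_seq _ _ xpredT (fun i => m i)).
pose h (F : {ffun finsupp m -> 'I_N.+1}) : {cmonom I} :=
  mkcmonom [fsfun i : finsupp m => (F i : nat) | 0%N].
apply: (@sub_finite_set _ _ (h @` [set: {ffun finsupp m -> 'I_N.+1}])); last first.
  exact/finite_image/finite_finset.
move=> a [b abm]; exists [ffun i => inord (a (val i))] => //.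
apply: cmonom_eqP => i; rewrite cmE /= fsfun_ffun.
have ai : m i = (a i + b i)%N by rewrite -abm cmM.
case: insubP => [u _ ui|]; last first.
  by move: (ai); case: (mdomP m i) => // _ /esym/eqP; rewrite addn_eq0 => /andP[/eqP->].
have aN : (a i <= N)%N by rewrite (leq_trans _ (leN i)) // ai leq_addr.
by rewrite /= ffunE /= -[fsval u]/(val u) ui inordK.
Qed.

Lemma finite_mfactors m : finite_set (mfactors m).
Proof.
apply: (@sub_finite_set _ _ (mdivs m `*` mdivs m)); last first.
  exact/finite_setX/finite_mdivs/finite_mdivs.
by move=> [a b] /= abm; split; [exists b|exists a; rewrite mulmC].
Qed.

Section Zmod.
Context {R : zmodType}.
Implicit Types f g h : pseries I R.

HB.instance Definition _ := [isNew for @pcoef I R].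
HB.instance Definition _ := [Choice of pseries I R by <:].

Lemma pseriesP f g : (forall m, pcoef f m = pcoef g m) -> f = g.
Proof. by case: f g => [f] [g] /= fg; congr PSeries; apply/funext. Qed.

Definition ps0 : pseries I R := PSeries (fun=> 0).
Definition psopp f := PSeries (fun m => - pcoef f m).
Definition psadd f g := PSeries (fun m => pcoef f m + pcoef g m).

Lemma psaddA : associative psadd.
Proof. by move=> f g h; apply: pseriesP => m /=; rewrite addrA. Qed.
Lemma psaddC : commutative psadd.
Proof. by move=> f g; apply: pseriesP => m /=; rewrite addrC. Qed.
Lemma psadd0 : left_id ps0 psadd.
Proof. by move=> f; apply: pseriesP => m /=; rewrite add0r. Qed.
Lemma psaddN : left_inverse ps0 psopp psadd.
Proof. by move=> f; apply: pseriesP => m /=; rewrite addNr. Qed.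

HB.instance Definition _ := GRing.isZmodule.Build (pseries I R)
  psaddA psaddC psadd0 psaddN.

End Zmod.

Section Ring.
Context {R : comNzRingType}.
Implicit Types f g h : pseries I R.

Definition ps1 : pseries I R := PSeries (fun m => (m == mone)%:R).

Definition psmul f g : pseries I R :=
  PSeries (fun m => \sum_(p \in mfactors m) pcoef f p.1 * pcoef g p.2).

Lemma psmulE f g m (X : {fset {cmonom I}}) : {subset fset_set (mdivs m) <= X} ->
  pcoef (psmul f g) m =
  \sum_(a <- X) \sum_(b <- X | mmul a b == m) pcoef f a * pcoef g b.
Proof.
move=> mX /=; have XX a b : mmul a b = m -> a \in X.
  by move=> abm; apply: mX; rewrite in_fset_set ?inE;
    [exists b|exact: finite_mdivs].
rewrite fsbig_finite; last exact: finite_mfactors.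
under [RHS]eq_bigr do rewrite big_mkcond /=.
rewrite -(@big_allpairs _ _ _ _ _ _ _ (fun p : {cmonom I} * {cmonom I} => if mmul p.1 p.2 == m
  then pcoef f p.1 * pcoef g p.2 else 0)) -[RHS]big_mkcond -[RHS]big_filter.
rewrite [LHS](perm_big [seq i <- [seq (i1, i2) | i1 <- X, i2 <- X] | mmul i.1 i.2 == m]) //=.
apply: uniq_perm => [||p].
- exact: fset_uniq.
- apply: filter_uniq; apply: allpairs_uniq; try exact: fset_uniq.
  by move=> [? ?] [? ?].
rewrite in_fset_set; last exact: finite_mfactors.
rewrite mem_filter; apply/idP/andP => [|[/eqP pm _]]; last by rewrite inE.
rewrite inE => pm; split; first exact/eqP.
case: p pm => a b /= abm; apply/allpairsP; exists (a, b); split => //=.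
  exact: XX abm.
by apply: (XX b a); rewrite mulmC.
Qed.

Lemma psmulC : commutative psmul.
Proof.
move=> f g; apply: pseriesP => m; rewrite !(@psmulE _ _ m (fset_set (mdivs m)))//.
rewrite (exchange_big_dep xpredT) //=; apply: eq_bigr => b _.
by apply: eq_big => [a|a _]; [rewrite mulmC|rewrite mulrC].
Qed.

Lemma psmul1 : left_id ps1 psmul.
Proof.
move=> f; apply: pseriesP => m /=.
rewrite (fsbigD1 (mone, m)) /=; [|exact: finite_mfactors|by rewrite /mfactors /= mul1m].
rewrite eqxx mul1r fsbig1 ?addr0// => -[a b] /= [abm /eqP nab].
case: eqP => [a1|_]; last by rewrite mul0r.
by move: nab; rewrite xpair_eqE -abm a1 mul1m !eqxx.
Qed.

Lemma psmulDl : left_distributive psmul (@psadd R).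
Proof.
move=> f g h; apply: pseriesP => m /=.
rewrite -fsbig_split; last exact: finite_mfactors.
by apply: eq_fsbigr => p _; rewrite mulrDl.
Qed.

Lemma psmul3E f g h m (X := fset_set (mdivs m)) :
  pcoef (psmul f (psmul g h)) m =
  \sum_(a <- X) \sum_(b <- X) \sum_(c <- X | mmul a (mmul b c) == m)
     pcoef f a * pcoef g b * pcoef h c.
Proof.
have XE a : (a \in X) = (a \in mdivs m) by rewrite in_fset_set //; exact: finite_mdivs.
rewrite (@psmulE _ _ m X)//; apply: eq_bigr => a _.
transitivity (\sum_(b <- X | mmul a b == m) \sum_(c <- X)
    \sum_(d <- X | mmul c d == b) pcoef f a * pcoef g c * pcoef h d).
  apply: eq_bigr => b /eqP abm; rewrite (@psmulE _ _ b X) => [|c].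
    by rewrite mulr_sumr; apply: eq_bigr => c _; rewrite mulr_sumr;
       apply: eq_bigr => d _; rewrite mulrA.
  rewrite XE in_fset_set; last exact: finite_mdivs.
  by rewrite !inE => -[d cdb]; exists (mmul a d); rewrite mulmA (mulmC c) -mulmA cdb.
rewrite exchange_big /=; apply: eq_bigr => c _.
rewrite (exchange_big_dep (fun d => mmul a (mmul c d) == m)) /=; last first.
  by move=> b d /eqP <- /eqP ->.
apply: eq_bigr => d /eqP acd.
rewrite -big_filter (_ : [seq _ <- _ | _] = [:: mmul c d]) ?big_seq1 //.
have : perm_eq [seq i <- X | (mmul a i == m) && (mmul c d == i)] [:: mmul c d].
  apply: uniq_perm => // [|b]; first exact/filter_uniq/fset_uniq.
  rewrite mem_filter mem_seq1; apply/andP/eqP => [[/andP[_ /eqP <-]]|->] //.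
  by rewrite acd !eqxx XE inE; split=> //; exists a; rewrite mulmC.
by move/perm_small_eq => -> .
Qed.

Lemma psmulA : associative psmul.
Proof.
move=> f g h; rewrite [RHS]psmulC; apply: pseriesP => m; rewrite !psmul3E.
rewrite [RHS]exchange_big /=; apply: eq_bigr => a _.
rewrite [RHS](exchange_big_dep xpredT) //=; apply: eq_bigr => b _.
by apply: eq_big => [c|c _]; [rewrite mulmA [mmul _ c]mulmC|rewrite mulrC mulrA].
Qed.

Lemma ps1_neq0 : ps1 != 0.
Proof.
apply/eqP => /(congr1 (fun f => pcoef f mone))/eqP.
by rewrite /= eqxx oner_eq0.
Qed.

HB.instance Definition _ := GRing.Zmodule_isComNzRing.Build (pseries I R)
  psmulA psmulC psmul1 psmulDl ps1_neq0.

(* The series obtained from f by replacing every variable by its r-th power:  *)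
(* the monomial a contributes to the monomial a ^ r.  This is meant for       *)
(* 0 < r, where the sum has at most one term.                                 *)
Definition psubst (r : nat) f : pseries I R :=
  PSeries (fun m => \sum_(a \in [set a | expcmn a r = m]) pcoef f a).

End Ring.
End PSeriesRing.

Notation posn := {n : nat | (0 < n)%N}.

(* The pair (i, j) stands for the variable x_{i,j}, of degree i.              *)
Notation xmonom := {cmonom (posn * posn)%type}.
Notation xseries := (pseries (posn * posn)%type rat).

Definition wdeg (m : xmonom) : nat := (\sum_(v <- finsupp m) val v.1 * m v)%N.

Definition squarefree (m : xmonom) : bool := [forall v : finsupp m, m (val v) <= 1]%N.

Definition Hseries (d : nat) : xseries := PSeries (fun m => (wdeg m == d)%:R).

Definition Eplus (d : nat) : xseries :=
  PSeries (fun m => ((wdeg m == d) && squarefree m)%:R).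

Notation composition := (seq posn).

Definition csize (alpha : composition) : nat := sumn (map val alpha).

(* delta i is the composition delta|^i.  Since each nonempty delta|^i adds at *)
(* least i to the size, a polycomposition of an integer has only finitely     *)
(* many nonempty terms, hence the finitely supported functions.               *)
Notation polycomposition := {fsfun posn -> composition with [::]}.

Definition pcsize (delta : polycomposition) : nat :=
  (\sum_(i <- finsupp delta) val i * csize (delta i))%N.

Definition PCom (n : nat) : set polycomposition :=
  [set delta | pcsize delta = n].

Definition PCom_dyad' (d : nat) : set polycomposition :=
  [set delta | [/\ PCom d delta,
     forall i : posn, delta i <> [::] -> exists k : nat, val i = (2 ^ k)%N &
     forall i : posn, (size (delta i) <= 1)%N]].

Definition Eplus_block (d r : nat) : xseries := psubst r (Eplus d).

Definition Eplus_poly (delta : polycomposition) : xseries :=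
  \prod_(r <- finsupp delta) \prod_(d <- delta r) Eplus_block (val d) (val r).

Lemma finite_PCom_dyad' d : finite_set (PCom_dyad' d).
Proof.
pose P : seq posn := pmap insub (iota 0 d.+1).
have leP (i : posn) : (val i <= d)%N -> i \in P.
  by move=> id; rewrite mem_pmap_sub mem_iota.
pose X := [fset i in P]%fset.
pose h (F : {ffun X -> option X}) : polycomposition :=
  [fsfun i : X => if F i is Some p then [:: val p] else [::] | [::]].
apply: (@sub_finite_set _ _ (h @` [set: {ffun X -> option X}])); last first.
  exact/finite_image/finite_finset.
move=> delta [dd _ d1].
have le_d i p : p \in delta i -> (val i <= d)%N /\ (val p <= d)%N.
  move=> pi; have di : i \in finsupp delta.
    by rewrite mem_finsupp; apply: contraTneq pi => ->.
  have le_c : (val p <= csize (delta i))%N.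
    by rewrite /csize sumnE big_map (big_rem p) //= leq_addr.
  have le_s : (val i * csize (delta i) <= d)%N.
    by rewrite -dd /pcsize (big_fsetD1 i) //= leq_addr.
  have i0 : (0 < val i)%N := valP i.
  have p0 : (0 < val p)%N := valP p.
  split; last by rewrite (leq_trans le_c) // (leq_trans _ le_s) // leq_pmull.
  by rewrite (leq_trans _ le_s) // leq_pmulr // (leq_trans p0).
exists [ffun i => if delta (val i) is p :: _ then insub p else None] => //.
apply/fsfunP => i; rewrite fsfun_ffun.
case: insubP => [u _ ui|iX] /=.
  rewrite ffunE -[fsval u]/(val u) ui.
  case E : (delta i) (d1 i) => [|p [|q s]] //= _.
  have [|_ pd] := le_d i p; first by rewrite E inE.
  have pX : p \in X by rewrite !inE leP.
  by rewrite insubT.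
case E : (delta i) => [|p s] //; case/negP: iX.
by rewrite !inE leP //; case: (le_d i p) => //; rewrite E inE eqxx.
Qed.

(* Main.v *)
(* Fix a monomial m of degree d and K > d.  Writing the exponents of m in     *)
(* binary gives a unique factorization m = prod_(k < K) a_k ^ (2 ^ k) with    *)
(* every a_k square-free, so m has coefficient 1 in                           *)
(* prod_(k < K) sum_(n <= d) E^+_{n^(2^k)}.  Expanding this product           *)
(* distributively, the terms of degree d are those indexed by functions       *)
(* F : k |-> n_k with sum 2^k n_k = d.  Such functions are the dyadic         *)
(* polycompositions of d: n_k is the single part of delta|^(2^k), with        *)
(* n_k = 0 standing for the empty composition, as E^+_0 = 1.                  *)

Require Import Defs.
From mathcomp Require Import all_boot all_order all_algebra.
From mathcomp Require Import finmap.
From mathcomp Require Import boolp classical_sets functions cardinality fsbigop.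
From mathcomp Require Import monalg.
Local Open Scope ring_scope.

Import GRing.Theory.

(** Comparing coefficients at a single monomial [m] keeps every computation finite, although the
    series involve infinitely many variables. [pcoef_prod_sum_Eplus] carries the binary
    factorization, by induction on the number of digits. [pcomp_of_bij] identifies dyadic
    polycompositions of [d] with functions [F] on ['I_d.+1] of weighted sum [d]. *)

(** * Exponents and weighted degrees of monomials *)

Section Monomials.
Context {I : choiceType}.
Implicit Types (m a b : {cmonom I}) (r : nat).

Lemma expcmnE a r v : expcmn a r v = (r * a v)%N.
Proof.
case: r => [|r]; first by rewrite onecmE.
by rewrite /expcmn; elim: r => [|r IH] /=; rewrite ?mul1n // mulcmE IH [in RHS]mulSn.
Qed.

Definition map_cmonom (h : nat -> nat) m : {cmonom I} :=
  mkcmonom [fsfun v in finsupp m => h (m v) | 0%N].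

Lemma map_cmonomE h m v : h 0%N = 0%N -> map_cmonom h m v = h (m v).
Proof.
move=> h0; rewrite cmE fsfunE.
by case: (mdomP m v) => //; rewrite h0.
Qed.

Lemma expcmn_inj r : (0 < r)%N -> injective (fun a => expcmn a r).
Proof.
move=> r0 a b ab; apply: cmonom_eqP => v.
have /eqP := congr1 (fun m : {cmonom I} => m v) ab.
by rewrite !expcmnE eqn_pmul2l // => /eqP.
Qed.

End Monomials.

Section WeightedDegree.
Implicit Types m a b : xmonom.

Lemma wdeg_incl m (X : {fset posn * posn}) : (finsupp m `<=` X)%fset ->
  wdeg m = (\sum_(v <- X) val v.1 * m v)%N.
Proof.
move=> mX; apply: big_fset_incl => // v _ vm.
by rewrite (fsfun_dflt vm) muln0.
Qed.

Lemma wdegM a b : wdeg (mmul a b) = (wdeg a + wdeg b)%N.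
Proof.
pose X := (finsupp a `|` finsupp b)%fset.
rewrite (wdeg_incl _ X) ?mdomD // (wdeg_incl a X) ?fsubsetUl //.
rewrite (wdeg_incl b X) ?fsubsetUr // -big_split /=.
by apply: eq_bigr => v _; rewrite cmM mulnDr.
Qed.

Lemma wdegX a r : wdeg (expcmn a r) = (r * wdeg a)%N.
Proof.
rewrite (wdeg_incl _ (finsupp a)); last first.
  by apply/fsubsetP => v; rewrite -!cmE_neq0 expcmnE muln_eq0 negb_or => /andP[].
rewrite /wdeg big_distrr /=; apply: eq_bigr => v _.
by rewrite expcmnE mulnCA.
Qed.

Lemma wdeg1 : wdeg mone = 0%N.
Proof. by rewrite /wdeg big1 // => v _; rewrite cm1 muln0. Qed.

(** Every variable has degree at least 1. *)
Lemma le_wdeg m v : (m v <= wdeg m)%N.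
Proof.
case: (mdomP m v) => // vm; rewrite /wdeg (big_fsetD1 v) //=.
by rewrite (leq_trans _ (leq_addr _ _)) // leq_pmull // (valP v.1).
Qed.

Lemma squarefreeP m : reflect (forall v, m v <= 1)%N (squarefree m).
Proof.
apply: (iffP forallP) => h v; last exact: h.
by case: (mdomP m v) => // vm; exact: (h [` vm]%fset).
Qed.

End WeightedDegree.

(** * Coefficients of blocks and of their products *)

Section Coefficients.
Implicit Types f g : xseries.

Lemma pcoef_sum (J : Type) (s : seq J) (P : pred J) (F : J -> xseries) m :
  pcoef (\sum_(j <- s | P j) F j) m = \sum_(j <- s | P j) pcoef (F j) m.
Proof. exact: (big_morph (fun f => pcoef f m)). Qed.

(** Taking [r]-th powers is injective on monomials, so at most one term survives in [psubst]: the
    [r]-th root of [m], which exists and is square-free exactly when all exponents of [m] are 0 or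
    [r]. *)
Lemma pcoef_psubst_Eplus r n m : (0 < r)%N ->
  pcoef (psubst r (Eplus n)) m =
  ((wdeg m == r * n)%N && `[< forall v, m v = 0%N \/ m v = r >])%:R.
Proof.
move=> r0 /=; case: asboolP => [mr|mr]; last first.
  rewrite andbF fsbig1 // => a /= am; case: squarefreeP; rewrite ?andbF // => sa.
  case: mr => v; rewrite -am expcmnE.
  by case: (a v) (sa v) => [|[|//]] _; [left|right]; rewrite ?muln0 ?muln1.
pose a := map_cmonom (fun n => n %/ r)%N m.
have aE v : a v = (m v %/ r)%N by rewrite map_cmonomE // div0n.
have am : expcmn a r = m.
  apply: cmonom_eqP => v; rewrite expcmnE aE.
  by case: (mr v) => ->; rewrite ?div0n ?muln0 // divnn r0 muln1.
rewrite (_ : [set b | expcmn b r = m]%classic = [set a]%classic); last first.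
  apply/seteqP; split => b /=; last by move=> ->.
  by rewrite -am => /(expcmn_inj _ r0).
rewrite fsbig_set1 -am wdegX eqn_pmul2l //=.
rewrite (_ : squarefree a) //; apply/squarefreeP => v; rewrite aE.
by case: (mr v) => ->; rewrite ?div0n // divnn r0.
Qed.

Lemma psubst_Eplus0 r : (0 < r)%N -> psubst r (Eplus 0) = 1.
Proof.
move=> r0; apply: pseriesP => m; rewrite pcoef_psubst_Eplus // muln0 /=.
have -> : (wdeg m == 0%N) = (m == mone).
  apply/eqP/eqP => [m0|->]; last exact: wdeg1.
  apply: cmonom_eqP => v; rewrite cm1; apply/eqP.
  by have := le_wdeg m v; rewrite [X in (_ <= X)%N]m0 leqn0.
case: eqP => //= ->; case: asboolP => // -[] v.
by left; rewrite cm1.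
Qed.

Definition homogeneous f n := forall m, wdeg m <> n -> pcoef f m = 0.

(** Degrees add under [mmul], so in any factorization of a monomial of the wrong degree some factor
    has the wrong degree. *)
Lemma homogeneous_prod (J : Type) (s : seq J) (F : J -> xseries) (n : J -> nat) :
  (forall j, homogeneous (F j) (n j)) ->
  homogeneous (\prod_(j <- s) F j) (\sum_(j <- s) n j).
Proof.
move=> hF; elim: s => [|j s IH] m; rewrite !(big_nil, big_cons).
  by move=> m0 /=; case: eqP => // m1; case: m0; rewrite m1 wdeg1.
move=> mn; rewrite /= fsbig1 // => -[a b] /= abm.
case: (eqVneq (wdeg a) (n j)) => [an|/eqP/hF->]; last by rewrite mul0r.
rewrite (IH b) ?mulr0 // => bn; apply: mn.
by rewrite -abm wdegM an bn.
Qed.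

Lemma homogeneous_psubst_Eplus r n : (0 < r)%N ->
  homogeneous (psubst r (Eplus n)) (r * n).
Proof. by move=> r0 m /eqP/negPf mn; rewrite pcoef_psubst_Eplus // mn. Qed.

(** When all exponents are 0 or [r], only [n = wdeg m / r] contributes, and the bound on [wdeg m]
    keeps it within the truncated sum. *)
Lemma pcoef_sum_Eplus d r m : (0 < r)%N -> (wdeg m <= d)%N ->
  pcoef (\sum_(n < d.+1) psubst r (Eplus n)) m =
  (`[< forall v, m v = 0%N \/ m v = r >])%:R.
Proof.
move=> r0 md; rewrite pcoef_sum.
under eq_bigr do rewrite pcoef_psubst_Eplus //.
case: asboolP => mr; last by rewrite big1 // => i _; rewrite andbF.
have /dvdnP[n nE] : (r %| wdeg m)%N.
  by apply: dvdn_sum => v _; case: (mr v) => ->; rewrite ?muln0 ?dvdn0 // dvdn_mull.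
have nd : (n < d.+1)%N.
  by rewrite ltnS (leq_trans _ md) // nE leq_pmulr.
rewrite (bigD1 (Ordinal nd)) //= nE mulnC eqxx big1 ?addr0 // => i /eqP ni.
rewrite eqn_pmul2l //; case: eqP => // ni'; case: ni.
exact/val_inj.
Qed.

(* The unique factorization m = p * q, with exponents of p below 2 ^ K and    *)
(* those of q in {0, 2 ^ K}, splits off the leading binary digits.            *)
Lemma pcoef_prod_sum_Eplus d K m : (wdeg m <= d)%N ->
  pcoef (\prod_(k < K) \sum_(n < d.+1) psubst (2 ^ k) (Eplus n)) m =
  (`[< forall v, m v < 2 ^ K >]%N)%:R.
Proof.
elim: K m => [|K IH] m md.
  rewrite big_ord0 /=; congr (nat_of_bool _)%:R; apply/eqP/asboolP => [-> v|h].
    by rewrite cm1.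
  by apply: cmonom_eqP => v; apply/eqP; rewrite cm1 -leqn0 -ltnS h.
rewrite big_ord_recr; set P := \prod_(k < K) _ in IH *; set Q := \sum_(n < _) _.
have r0 : (0 < 2 ^ K)%N by rewrite expn_gt0.
(* Divisors of [m] also have degree at most [d], so each term of the convolution is 0 or 1. *)
have PQ a b : mmul a b = m -> pcoef P a * pcoef Q b =
    (`[< forall v, a v < 2 ^ K >]%N && `[< forall v, b v = 0%N \/ b v = 2 ^ K >]%N)%:R.
  move=> abm; rewrite IH ?pcoef_sum_Eplus -?natrM ?mulnb //.
    by rewrite (leq_trans _ md) // -abm wdegM leq_addl.
  by rewrite (leq_trans _ md) // -abm wdegM leq_addr.
rewrite /=; case: asboolP => mK; last first.
  (* An exponent below [2 ^ K] plus one that is at most [2 ^ K] stays below [2 ^ K.+1]. *)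
  rewrite fsbig1 // => -[a b] /= abm; rewrite PQ //.
  case: asboolP => //= aK; case: asboolP => //= bK; case: mK => v.
  rewrite -abm cmM expnS mul2n -addnn.
  by case: (bK v) => ->; rewrite ?addn0 ?ltn_add2r // ltn_addr.
pose a := map_cmonom (fun n => n %% 2 ^ K)%N m.
pose b := map_cmonom (fun n => n %/ 2 ^ K * 2 ^ K)%N m.
have aE v : a v = (m v %% 2 ^ K)%N by rewrite map_cmonomE // mod0n.
have bE v : b v = (m v %/ 2 ^ K * 2 ^ K)%N by rewrite map_cmonomE // div0n.
have abm : mmul a b = m.
  by apply: cmonom_eqP => v; rewrite cmM aE bE addnC -divn_eq.
rewrite (fsbigD1 (a, b)) //=; last exact: finite_mfactors.
rewrite PQ // fsbig1 ?addr0 => [|[a' b'] /= [abm' nab]].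
  case: asboolP => [_|[] v]; last by rewrite aE ltn_mod.
  case: asboolP => // -[] v; rewrite bE.
  have : (m v %/ 2 ^ K < 2)%N by rewrite ltn_divLR // -expnS.
  by case: (_ %/ _)%N => [|[|]] // _; [left|right; rewrite mul1n].
rewrite PQ //; case: asboolP => //= aK; case: asboolP => //= bK; case: nab.
(* Uniqueness: reducing the exponents of [m] modulo [2 ^ K] recovers those of [a']. *)
have a'E v : a' v = a v.
  rewrite aE -abm' cmM.
  by case: (bK v) => ->; rewrite ?addn0 ?modnDr modn_small.
congr pair; apply: cmonom_eqP => v; first exact: a'E.
by apply/eqP; rewrite -(eqn_add2l (a v)) -{1}a'E -!cmM abm abm'.
Qed.

End Coefficients.

(** * Dyadic polycompositions as functions of the binary exponent *)

Section DyadicPolycompositions.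
Implicit Type delta : polycomposition.

Definition pow2 (k : nat) : posn := exist _ (2 ^ k)%N (expn_gt0 2 k).

Lemma pow2_inj : injective pow2.
Proof.
move=> j k /(congr1 val)/eqP /=.
by rewrite eqn_exp2l // => /eqP.
Qed.

Definition pow2s (K : nat) : {fset posn} := [fset pow2 (val k) | k : 'I_K]%fset.

(** Replaces the support, which varies with [delta], by one common range of exponents; the added
    indices contribute only [idx]. *)
Lemma big_finsupp_pow2 (R : Type) (idx : R) (op : Monoid.com_law idx)
    (K : nat) delta (F : posn -> R) :
  (finsupp delta `<=` pow2s K)%fset ->
  (forall r, delta r = [::] -> F r = idx) ->
  \big[op/idx]_(r <- finsupp delta) F r = \big[op/idx]_(k < K) F (pow2 k).
Proof.
move=> sub F0; rewrite (big_fset_incl _ sub) => [|r _ /fsfun_dflt/F0//].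
rewrite big_imfset /=; last by move=> j k _ _ /pow2_inj/val_inj.
by rewrite big_enum.
Qed.

(** [insub] fails exactly at 0, so 0 gives the empty composition. *)
Definition compn (n : nat) : composition := seq_of_opt (insub n).

Lemma size_compn n : (size (compn n) <= 1)%N.
Proof. by rewrite /compn; case: insub. Qed.

Lemma csize_compn n : csize (compn n) = n.
Proof.
rewrite /compn /csize; case: insubP => [p _ pn|] /=; first by rewrite addn0.
by rewrite -eqn0Ngt => /eqP.
Qed.

Lemma compn_csize (alpha : composition) : (size alpha <= 1)%N ->
  compn (csize alpha) = alpha.
Proof.
case: alpha => [|p [|//]] _; first by rewrite /compn insubF.
by rewrite /compn /csize /= addn0 valK.
Qed.

Lemma prod_Eplus_block (alpha : composition) (r : posn) : (size alpha <= 1)%N ->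
  \prod_(n <- alpha) Eplus_block (val n) (val r) =
  psubst (val r) (Eplus (csize alpha)).
Proof.
case: alpha => [|p [|//]] _; last by rewrite big_seq1 /csize /= addn0.
by rewrite big_nil psubst_Eplus0 //; exact: (valP r).
Qed.

Lemma Eplus_poly_pow2 K delta : (finsupp delta `<=` pow2s K)%fset ->
  (forall r, size (delta r) <= 1)%N ->
  Eplus_poly delta =
  \prod_(k < K) psubst (2 ^ k) (Eplus (csize (delta (pow2 k)))).
Proof.
move=> sub d1; rewrite /Eplus_poly (big_finsupp_pow2 _ _ _ K) //.
  by apply: eq_bigr => k _; rewrite prod_Eplus_block.
by move=> r ->; rewrite big_nil.
Qed.

Lemma pcsize_pow2 K delta : (finsupp delta `<=` pow2s K)%fset ->
  pcsize delta = (\sum_(k < K) 2 ^ k * csize (delta (pow2 k)))%N.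
Proof.
move=> sub; rewrite /pcsize (big_finsupp_pow2 _ _ _ K) // => r ->.
by rewrite muln0.
Qed.

(** A nonempty term at [2 ^ k] adds at least [2 ^ k] to the size, whence [k < 2 ^ k <= d]. *)
Lemma PCom_dyad'_finsupp d delta :
  PCom_dyad' d delta -> (finsupp delta `<=` pow2s d.+1)%fset.
Proof.
move=> [dd dyad _]; apply/fsubsetP => r dr.
have := dr; rewrite mem_finsupp => /eqP dr0.
have [k rk] := dyad r dr0.
have rd : (val r <= d)%N.
  rewrite -dd /pcsize (big_fsetD1 r) //= (leq_trans _ (leq_addr _ _)) //.
  rewrite leq_pmulr //; case: (delta r) dr0 => // p s _.
  by rewrite /csize /= ltn_addr // (valP p).
have kd : (k < d.+1)%N.
  by rewrite (leq_trans _ (leqW rd)) // rk ltn_expl.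
apply/imfsetP; exists (Ordinal kd) => //; exact/val_inj.
Qed.

Context {K D : nat}.
Implicit Type F : {ffun 'I_K -> 'I_D}.

(** On [pow2s K], [trunc_log 2] recovers the exponent [k] from the multiplicity [2 ^ k]. *)
Definition pcomp_of F : polycomposition :=
  [fsfun r in pow2s K =>
     oapp (fun k => compn (F k)) [::] (insub (trunc_log 2 (val r)))].

Lemma pcomp_of_pow2 F (k : 'I_K) : pcomp_of F (pow2 k) = compn (F k).
Proof.
rewrite fsfunE ifT /=; last by apply/imfsetP; exists k.
by rewrite trunc_expnK // valK.
Qed.

Lemma finsupp_pcomp_of F : (finsupp (pcomp_of F) `<=` pow2s K)%fset.
Proof. exact: finsupp_sub. Qed.

Lemma size_pcomp_of F r : (size (pcomp_of F r) <= 1)%N.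
Proof.
rewrite fsfunE; case: ifP => // _.
by case: insub => //= k; exact: size_compn.
Qed.

Lemma pcomp_of_inj : injective pcomp_of.
Proof.
move=> F G FG; apply/ffunP => k; apply/val_inj.
by rewrite /= -(csize_compn (F k)) -pcomp_of_pow2 FG pcomp_of_pow2 csize_compn.
Qed.

End DyadicPolycompositions.

(** The inverse sends [delta] to the sizes [csize (delta (pow2 k))]; each is at most [d], being
    bounded by its own contribution to the total size. *)
Lemma pcomp_of_bij (d : nat) :
  set_bij [set F : {ffun 'I_d.+1 -> 'I_d.+1} | \sum_(k < d.+1) 2 ^ k * F k = d]%N%classic
    (PCom_dyad' d) pcomp_of.
Proof.
split=> [F /= Fd|F G _ _|delta dd]; last 1 first.
- have sub := PCom_dyad'_finsupp _ _ dd.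
  have [dE _ d1] := dd; move: (dE); rewrite /PCom /= (pcsize_pow2 _ _ sub) => sumd.
  have cd (k : 'I_d.+1) : (csize (delta (pow2 k)) < d.+1)%N.
    rewrite ltnS -[leqRHS]sumd (bigD1 k) //= (leq_trans _ (leq_addr _ _)) //.
    by rewrite leq_pmull // expn_gt0.
  exists [ffun k => Ordinal (cd k)].
    by rewrite /= -[RHS]sumd; apply: eq_bigr => k _; rewrite ffunE.
  apply/fsfunP => r; case: (boolP (r \in pow2s d.+1)) => [/imfsetP[k _ ->]|rn].
    by rewrite pcomp_of_pow2 ffunE compn_csize.
  rewrite !fsfun_dflt //; apply: contra rn; apply: fsubsetP => //.
  exact: finsupp_pcomp_of.
- split; [| |exact: size_pcomp_of].
    rewrite /PCom /= (pcsize_pow2 _ _ (finsupp_pcomp_of F)) -[RHS]Fd.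
    by apply: eq_bigr => k _; rewrite pcomp_of_pow2 csize_compn.
  move=> r /eqP; rewrite -mem_finsupp => /(fsubsetP (finsupp_pcomp_of F)).
  by move=> /imfsetP[k _ ->]; exists k.
- exact: pcomp_of_inj.
Qed.

(** * From the sum over polycompositions to the expanded product *)

Lemma sum_PCom_dyad' (d : nat) :
  \sum_(delta \in PCom_dyad' d) Eplus_poly delta =
  \sum_(F : {ffun 'I_d.+1 -> 'I_d.+1} | (\sum_(k < d.+1) 2 ^ k * F k == d)%N)
    \prod_(k < d.+1) psubst (2 ^ k) (Eplus (F k)).
Proof.
rewrite (reindex_fsbig _ _ _ _ (pcomp_of_bij d)).
rewrite [RHS]bigfs ?index_enum_uniq // => [|F _]; last by rewrite mem_index_enum.
rewrite (_ : [set` _]%classic = [set F : {ffun 'I_d.+1 -> 'I_d.+1} |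
  \sum_(k < d.+1) 2 ^ k * F k = d]%N%classic); last first.
  by apply/seteqP; split => F /= /eqP.
apply: eq_fsbigr => F _.
rewrite (Eplus_poly_pow2 d.+1); [|exact: finsupp_pcomp_of|exact: size_pcomp_of].
by apply: eq_bigr => k _; rewrite pcomp_of_pow2 csize_compn.
Qed.

Theorem proposition28 (d : nat) :
  Hseries d = \sum_(delta \in PCom_dyad' d) Eplus_poly delta.
Proof.
rewrite sum_PCom_dyad'; apply: pseriesP => m; rewrite pcoef_sum /=.
have homF (F : {ffun 'I_d.+1 -> 'I_d.+1}) :
    homogeneous (\prod_(k < d.+1) psubst (2 ^ k) (Eplus (F k)))
      (\sum_(k < d.+1) 2 ^ k * F k).
  by apply: homogeneous_prod => k; apply: homogeneous_psubst_Eplus; rewrite expn_gt0.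
case: eqP => [md|md]; last first.
  by rewrite big1 // => F /eqP Fd; apply: homF; rewrite Fd.
(* Since [wdeg m = d], functions [F] of any other weighted sum contribute 0 and may be added
   freely. *)
transitivity (\sum_(F : {ffun 'I_d.+1 -> 'I_d.+1}) pcoef (\prod_(k < d.+1)
    psubst (2 ^ k) (Eplus (F k))) m); last first.
  rewrite [RHS]big_mkcond; apply: eq_bigr => F _; case: eqP => // Fd.
  by apply: homF; rewrite md => /esym.
rewrite -pcoef_sum.
rewrite -(bigA_distr_bigA (fun k n : 'I_d.+1 => psubst (2 ^ k) (Eplus n))).
rewrite pcoef_prod_sum_Eplus ?md //; case: asboolP => // -[] v.
(* Taking [d.+1] digits is enough: [m v <= d < d.+1 < 2 ^ d.+1]. *)
by rewrite (leq_ltn_trans (le_wdeg m v)) // [X in (X < _)%N]md (ltn_trans (ltnSn d)) // ltn_expl.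
Qed.
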